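(* Let $k\ge2$ be an integer, $\varepsilon\in(0,1]$, $\gamma>\frac12$, and assume $$\tau\lesssim\min\bigl\{\varepsilon^{1+\sigma_0},\ N^{-(1+\sigma_0)}\bigr\}$$ for some fixed $\sigma_0>0$ (which may be arbitrarily small). Let $M>0$. Then there exists $\tau_M>0$, independent of $\varepsilon$, $\tau$ and $N$, such that for all $0<\tau\le\tau_M$ and every $u_N^n\in Y_N$ with $\|u_N^n\|_{H^\gamma}\le M$, the sequence $\{u_{N,(i)}^{n+1}\}_{i=0}^\infty$ generated by $$u_{N,(0)}^{n+1}=u_N^n,\qquad u_{N,(i+1)}^{n+1}=\psi_{u_N^n}\bigl(u_{N,(i)}^{n+1}\bigr),\quad i=0,1,\dots$$ converges to the unique solution $u_N^{n+1}$ in $B_{2M}$ of $u_N^{n+1}=\psi_{u_N^n}(u_N^{n+1})$, and $$\bigl\|u_{N,(i)}^{n+1}-u_N^{n+1}\bigr\|_{H^\gamma}\le\frac1{2^{\,i-1}}\bigl\|u_{N,(1)}^{n+1}-u_{N,(0)}^{n+1}\bigr\|_{H^\gamma},\qquad i\in\mathbb Z_+ .$$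
   Context: $\mathbb T=(-\pi,\pi)$ with periodic boundary conditions; $\tau>0$; $N$ is an even positive integer. Fourier coefficients: $\widehat u(\xi)=\frac1{2\pi}\int_{\mathbb T}u(x)e^{-\mathrm i\xi(x+\pi)}\,dx$. Norm: $\|u\|_{H^\gamma}=\bigl(\sum_{\xi\in\mathbb Z}(1+\xi^2)^\gamma|\widehat u(\xi)|^2\bigr)^{1/2}$. $Y_N=\operatorname{span}\{e^{\mathrm i\xi(x+\pi)}:\xi=-\frac N2,\dots,\frac N2\}$, $P_N:L^2(\mathbb T)\to Y_N$ is the orthogonal projection $P_Nu=\sum_{\xi=-N/2}^{N/2}\widehat u(\xi)e^{\mathrm i\xi(x+\pi)}$, and $B_R=\{\phi\in Y_N:\|\phi\|_{H^\gamma}\le R\}$. For $w\in Y_N$, the map $\psi_w:Y_N\to Y_N$ is $$\psi_w(\phi)=\bigl(\mathcal A^+_{\tau,\varepsilon}\bigr)^{-1}\mathcal A^-_{\tau,\varepsilon}w-\frac\tau k\bigl(\mathcal A^+_{\tau,\varepsilon}\bigr)^{-1}\partial_xP_N\Bigl(\bigl(\tfrac{w+\phi}2\bigr)^k\Bigr),\qquad \mathcal A^\pm_{\tau,\varepsilon}=I\pm\tfrac12\varepsilon^2\tau\partial_x^3 .$$ The equation $u_N^{n+1}=\psi_{u_N^n}(u_N^{n+1})$ is equivalent to the Crank–Nicolson step $\frac1\tau(u_N^{n+1}-u_N^n)+\varepsilon^2\partial_x^3u_N^{n+1/2}+\frac1kP_N\partial_x\bigl((u_N^{n+1/2})^k\bigr)=0$,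 with $u_N^{n+1/2}=\frac12(u_N^{n+1}+u_N^n)$. $A\lesssim B$ means $|A|\le C_0B$ for some constant $C_0>0$ independent of $\varepsilon,\tau,N$; $k,\gamma,\sigma_0$ and the constant implied in the step-size condition are regarded as fixed. *)

(* Defs.v *)
From HB Require Import structures.
From mathcomp Require Import all_boot all_order all_algebra.
From mathcomp Require Import complex.
From mathcomp Require Import all_classical all_reals all_analysis.

Set Implicit Arguments.
Unset Strict Implicit.
Unset Printing Implicit Defensive.

Import Order.TTheory GRing.Theory Num.Theory.
Import numFieldNormedType.Exports.

Local Open Scope classical_set_scope.
Local Open Scope ring_scope.
Local Open Scope complex_scope.

(* A function on the torus is a complex-valued function of a real variable;
   the elements of [trigpoly N] below are 2 pi-periodic, and Fourier
   coefficients only use the values on the fundamental domain ]-pi, pi[. *)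
Section Torus.
Context {R : realType}.
Implicit Types (u v w phi : R -> R[i]) (N k : nat) (eps tau gamma : R).

Definition cis (t : R) : R[i] := cos t +i* sin t.

Definition fmode (xi : int) : R -> R[i] :=
  fun x => cis (xi%:~R * (x + pi)).

Definition cintegral (D : set R) (f : R -> R[i]) : R[i] :=
  (\int[lebesgue_measure]_(x in D) complex.Re (f x)) +i*
  (\int[lebesgue_measure]_(x in D) complex.Im (f x)).

Definition fourier u (xi : int) : R[i] :=
  ((2 * pi)^-1)%:C *
  cintegral `]- pi, pi[ (fun x => u x * cis (- (xi%:~R * (x + pi)))).

(* Extended-real valued, hence [+oo] when u is not in H^gamma. *)
Definition Hnorm gamma u : \bar R :=
  poweR (\esum_(xi in [set: int])
           ((1 + xi%:~R ^+ 2) `^ gamma * Normc.normc (fourier u xi) ^+ 2)%:E)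
        2^-1.

(* For N even, j |-> freq N j enumerates -N/2, ..., N/2 for 0 <= j <= N. *)
Definition freq N (j : nat) : int := j%:Z - (N./2)%:Z.

Definition trigpoly N : set (R -> R[i]) :=
  [set u | exists c : int -> R[i],
     u = fun x => \sum_(j < N.+1) c (freq N j) * fmode (freq N j) x].

Definition projY N u : R -> R[i] :=
  fun x => \sum_(j < N.+1) fourier u (freq N j) * fmode (freq N j) x.

Definition ballY N gamma (r : R) : set (R -> R[i]) :=
  [set u | trigpoly N u /\ (Hnorm gamma u <= r%:E)%E].

Definition cderive u : R -> R[i] :=
  fun x => derive1 (fun y => complex.Re (u y)) x +i* derive1 (fun y => complex.Im (u y)) x.

Definition Aplus eps tau u : R -> R[i] :=
  fun x => u x + (2^-1 * eps ^+ 2 * tau)%:C * iter 3 cderive u x.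

Definition Aminus eps tau u : R -> R[i] :=
  fun x => u x - (2^-1 * eps ^+ 2 * tau)%:C * iter 3 cderive u x.

(* The inverse of [Aplus eps tau] as an operator on [trigpoly N]. *)
Definition Aplus_inv eps tau N : (R -> R[i]) -> (R -> R[i]) :=
  'pinv_(fun=> (fun=> 0)) (trigpoly N) (Aplus eps tau).

Definition psi eps tau N k w phi : R -> R[i] :=
  fun x =>
    Aplus_inv eps tau N (Aminus eps tau w) x -
    (tau / k%:R)%:C *
    Aplus_inv eps tau N
      (cderive (projY N (fun y => ((w y + phi y) / 2) ^+ k))) x.

Definition picard eps tau N k w (i : nat) : R -> R[i] :=
  iter i (psi eps tau N k w) w.

End Torus.

(* Main.v *)
Require Import Defs.
From HB Require Import structures.
From mathcomp Require Import all_boot all_order all_algebra.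
From mathcomp Require Import complex.
From mathcomp Require Import all_classical all_reals all_analysis.
From mathcomp Require Import measurable_realfun ring lra zify.
Import Order.TTheory GRing.Theory Num.Theory.
Import numFieldNormedType.Exports.
Local Open Scope classical_set_scope.
Local Open Scope ring_scope.

(* On Y_N the derivative costs a factor N/2, the multipliers A^-/A^+ and 1/A^+
   have modulus at most 1 on every frequency, and H^gamma is an algebra since
   2 gamma > 1. Hence the nonlinear part of psi_w is Lipschitz on B_2M with a
   constant O(tau N), and the step-size condition gives
   (tau N)^(1+sigma0) <= C0 tau^sigma0, which is small with tau. So psi_w maps
   B_2M to itself and contracts by 1/2; Banach's iteration concludes.
   A trigonometric polynomial is encoded by its algebraic polynomial in
   z = e^(i(x+pi)), the exponents being shifted by an offset K; products of
   functions become products of polynomials. *)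

(** * Trigonometric polynomials *)
Section Trigo.
Local Open Scope complex_scope.
Context {R : realType}.
Implicit Types (x t : R) (c : R[i]).

(** Offsets add under products, so a k-th power of an element of Y_N lives at offset [N./2 * k]
    while everything else lives at [N./2]. The norm [hnorm gamma K] therefore carries its offset,
    and the algebra constant has to be uniform in both offsets; this uniformity is what makes the
    final time step independent of N. Fourier coefficients recover a polynomial from its function,
    hence equations between functions and equations between polynomials can be exchanged.
    Completeness is obtained by hand: all iterates have at most N + 1 coefficients, and each
    coefficient converges geometrically. *)

Lemma cisD t1 t2 : cis (t1 + t2) = cis t1 * cis t2 :> R[i].
Proof.
rewrite /cis cosD sinD; apply/eqP; rewrite eq_complex /=.
by rewrite eqxx [X in _ == X]addrC eqxx.
Qed.

Lemma cis0 : cis 0 = 1 :> R[i].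
Proof. by rewrite /cis cos0 sin0. Qed.

Lemma cis_natM (n : nat) t : cis (n%:R * t) = cis t ^+ n :> R[i].
Proof.
elim: n => [|n IH]; first by rewrite mul0r cis0 expr0.
by rewrite -natr1 mulrDl mul1r cisD IH exprSr.
Qed.

Lemma fmodeD (m n : int) x : fmode (m + n) x = fmode m x * fmode n x :> R[i].
Proof. by rewrite /fmode -cisD intrD mulrDl. Qed.

Lemma fmode0 x : fmode 0 x = 1 :> R[i].
Proof. by rewrite /fmode mul0r cis0. Qed.

Lemma cis_mul2pi (n : int) : cis (n%:~R * (2 * pi)) = 1 :> R[i].
Proof.
have natcis (m : nat) : cis (m%:R * (2 * pi)) = 1 :> R[i].
  rewrite cis_natM (_ : cis _ = 1) ?expr1n //.
  by rewrite /cis mulr_natl cos2pi sin2pi.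
case: n => n; first exact: natcis.
rewrite NegzE mulrNz mulNr.
have := cisD (n.+1%:R * (2 * pi)) (- (n.+1%:R * (2 * pi))).
by rewrite subrr cis0 natcis mul1r.
Qed.

(** [derive1] is total, with no information where the function is not differentiable. The relation
    keeps differentiability of both parts, so it passes through sums and scalings. *)
Definition is_cderive (F f : R -> R[i]) := forall x,
  is_derive x 1 (fun y => complex.Re (F y)) (complex.Re (f x)) /\
  is_derive x 1 (fun y => complex.Im (F y)) (complex.Im (f x)).

Lemma is_cderiveE F f : is_cderive F f -> cderive F = f.
Proof.
move=> Ff; apply/funext => x; rewrite /cderive !derive1E.
have [F1 F2] := Ff x.
by rewrite (@derive_val _ _ _ _ _ _ _ F1) (@derive_val _ _ _ _ _ _ _ F2); case: (f x).
Qed.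

Lemma eq_is_cderive F G f g : F =1 G -> f =1 g ->
  is_cderive F f -> is_cderive G g.
Proof. by move=> /funext -> /funext ->. Qed.

Lemma is_cderive_cst c : is_cderive (fun=> c) (fun=> 0).
Proof. by move=> x; split; exact: is_derive_cst. Qed.

Lemma is_cderiveD F G f g : is_cderive F f -> is_cderive G g ->
  is_cderive (fun x => F x + G x) (fun x => f x + g x).
Proof.
move=> Ff Gg x; have [F1 F2] := Ff x; have [G1 G2] := Gg x.
have e1 := is_deriveD F1 G1; have e2 := is_deriveD F2 G2.
rewrite !raddfD /=; split.
- rewrite (_ : (fun _ => _) = (fun y => complex.Re (F y)) \+ (fun y => complex.Re (G y))) //.
  by apply/funext => y; rewrite raddfD.
- rewrite (_ : (fun _ => _) = (fun y => complex.Im (F y)) \+ (fun y => complex.Im (G y))) //.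
  by apply/funext => y; rewrite raddfD.
Qed.

Lemma is_cderiveZ c F f : is_cderive F f ->
  is_cderive (fun x => c * F x) (fun x => c * f x).
Proof.
move=> Ff x; have [F1 F2] := Ff x; case: c => a b.
have e1 := is_deriveB (is_deriveZ a F1) (is_deriveZ b F2).
have e2 := is_deriveD (is_deriveZ a F2) (is_deriveZ b F1).
split.
- have -> : complex.Re ((a +i* b) * f x) = a *: complex.Re (f x) - b *: complex.Im (f x).
    by case: (f x).
  rewrite (_ : (fun _ => _) =
    (a \*: (fun y => complex.Re (F y))) - (b \*: (fun y => complex.Im (F y)))) //.
  by apply/funext => y /=; rewrite ?fctE /GRing.scale_fun /=; case: (F y).
- have -> : complex.Im ((a +i* b) * f x) = a *: complex.Im (f x) + b *: complex.Re (f x).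
    by case: (f x).
  rewrite (_ : (fun _ => _) =
    (a \*: (fun y => complex.Im (F y))) + (b \*: (fun y => complex.Re (F y)))) //.
  by apply/funext => y /=; rewrite ?fctE /GRing.scale_fun /=; case: (F y).
Qed.

Lemma is_cderive_sum n (F f : 'I_n -> R -> R[i]) :
  (forall i, is_cderive (F i) (f i)) ->
  is_cderive (fun x => \sum_(i < n) F i x) (fun x => \sum_(i < n) f i x).
Proof.
elim: n F f => [|n IH] F f Ff.
  by apply: eq_is_cderive (is_cderive_cst 0) => x; rewrite big_ord0.
apply: eq_is_cderive (is_cderiveD _ _ _ _ (Ff ord0)
  (IH _ _ (fun i => Ff (lift ord0 i)))) => x; by rewrite big_ord_recl.
Qed.

Lemma is_cderive_fmode (xi : int) :
  is_cderive (fmode xi) (fun x => ('i * xi%:~R%:C) * fmode xi x).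
Proof.
move=> x.
have lin : is_derive x 1 (fun y : R => xi%:~R * (y + pi)) xi%:~R.
  have := is_deriveZ xi%:~R (is_deriveD (is_derive_id x 1) (is_derive_cst (pi : R) x 1)).
  by rewrite addr0 /= [_ *: 1]mulr1.
have := @is_derive1_comp R cos (fun y => xi%:~R * (y + pi)) x _ _ (is_derive_cos _) lin.
have := @is_derive1_comp R sin (fun y => xi%:~R * (y + pi)) x _ _ (is_derive_sin _) lin.
rewrite /fmode /cis /= => H1 H2; split.
(* The left-hand side is the real part of [('i * xi%:~R%:C) * fmode xi x] as simplification unfolds
   it; the imaginary part follows likewise. *)
- by have -> : (0 * xi%:~R - 1 * 0) * cos (xi%:~R * (x + pi)) -
      (0 * 0 + 1 * xi%:~R) * sin (xi%:~R * (x + pi)) =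
   - sin (xi%:~R * (x + pi)) * xi%:~R by ring.
- by have -> : (0 * xi%:~R - 1 * 0) * sin (xi%:~R * (x + pi)) +
      (0 * 0 + 1 * xi%:~R) * cos (xi%:~R * (x + pi)) =
   cos (xi%:~R * (x + pi)) * xi%:~R by ring.
Qed.

Lemma derive_continuous (g : R -> R) (dg : R -> R) :
  (forall x, is_derive x 1 g (dg x)) -> continuous g.
Proof.
move=> h x; apply/differentiable_continuous/derivable1_diffP.
by have [] := h x.
Qed.

Lemma Rintegral_FTC2 (G g : R -> R) (a b : R) : a < b -> continuous g ->
  (forall x, is_derive x 1 G (g x)) ->
  \int[lebesgue_measure]_(x in `]a, b[) g x = G b - G a.
Proof.
move=> ab cg dG.
have cG := derive_continuous _ _ dG.
(* The fundamental theorem is available on closed intervals; the endpoints have measure zero. *)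
rewrite /Rintegral -(integral_itv_bndoo true false); last first.
  apply/measurable_EFinP; apply: measurable_funTS.
  exact: continuous_measurable_fun.
rewrite (@continuous_FTC2 _ g G) //.
- by apply: continuous_subspaceT.
- split.
  + by move=> x _; have [] := dG x.
  + by apply: cvg_at_right_filter; apply: cG.
  + by apply: cvg_at_left_filter; apply: cG.
- by move=> x _; rewrite derive1E; apply: (@derive_val _ _ _ _ _ _ _ (dG x)).
Qed.

(** The derivative [df] supplies the continuity of the integrand [f]. *)
Lemma cintegral_FTC2 (F f df : R -> R[i]) (a b : R) : a < b ->
  is_cderive F f -> is_cderive f df ->
  cintegral `]a, b[ f = F b - F a.
Proof.
move=> ab Ff fdf; rewrite /cintegral.
rewrite (Rintegral_FTC2 _ _ _ _ ab
  (derive_continuous _ _ (fun x => (fdf x).1)) (fun x => (Ff x).1)).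
rewrite (Rintegral_FTC2 _ _ _ _ ab
  (derive_continuous _ _ (fun x => (fdf x).2)) (fun x => (Ff x).2)).
by case: (F b) (F a) => ? ? [? ?].
Qed.

(** * Encoding by polynomials, Fourier coefficients and multipliers *)

Implicit Types (p q : {poly R[i]}) (K : nat).

Definition tpoly K p : R -> R[i] :=
  fun x => \sum_(j < size p) p`_j * fmode (j%:Z - K%:Z) x.

Lemma tpolyE n K p x : (size p <= n)%N ->
  tpoly K p x = \sum_(j < n) p`_j * fmode (j%:Z - K%:Z) x.
Proof.
move=> pn; rewrite /tpoly.
rewrite (big_ord_widen n (fun j => p`_j * fmode (j%:Z - K%:Z) x) pn) big_mkcond /=.
by apply: eq_bigr => j _; case: ltnP => // ?; rewrite nth_default ?mul0r.
Qed.

(** Evaluation at e^(i(x+pi)) is a ring morphism, so the algebraic rules below reduce to those of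
    [horner]. *)
Lemma tpoly_horner K p x :
  tpoly K p x = fmode (- K%:Z) x * p.[fmode 1 x].
Proof.
rewrite horner_coef mulr_sumr; apply: eq_bigr => j _.
rewrite fmodeD [RHS]mulrCA; congr (_ * _); rewrite mulrC; congr (_ * _).
by rewrite /fmode mul1r -cis_natM.
Qed.

Lemma tpolyB K p q x : tpoly K (p - q) x = tpoly K p x - tpoly K q x.
Proof. by rewrite !tpoly_horner hornerD hornerN mulrBr. Qed.

Lemma tpolyD K p q x : tpoly K (p + q) x = tpoly K p x + tpoly K q x.
Proof. by rewrite !tpoly_horner hornerD mulrDr. Qed.

Lemma tpolyZ K c p x : tpoly K (c *: p) x = c * tpoly K p x.
Proof. by rewrite !tpoly_horner hornerZ mulrCA. Qed.

Lemma tpolyX K p n x : tpoly (K * n) (p ^+ n) x = tpoly K p x ^+ n.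
Proof.
rewrite !tpoly_horner exprMn horner_exp; congr (_ * _).
elim: n => [|n IH]; first by rewrite muln0 oppr0 fmode0 expr0.
by rewrite mulnS exprS -IH -fmodeD PoszD opprD.
Qed.

(** An antiderivative of [fmode n]. It is periodic except for n = 0, which is the orthogonality of
    the modes. *)
Definition antimode (n : int) : R -> R[i] := fun x =>
  if n == 0 then x%:C else ('i * n%:~R%:C)^-1 * fmode n x.

Lemma is_cderive_antimode n : is_cderive (antimode n) (fmode n).
Proof.
rewrite /antimode; have [->|n0] := eqVneq n 0.
  apply: (@eq_is_cderive (fun x => x%:C) _ (fun=> 1)) => // x.
    by rewrite fmode0.
  by split => /=; [exact: is_derive_id|exact: is_derive_cst].
apply: eq_is_cderive (is_cderiveZ ('i * n%:~R%:C)^-1 _ _ (is_cderive_fmode n)) => x //.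
rewrite mulrA mulVf ?mul1r // mulf_eq0 negb_or; apply/andP; split.
  by rewrite eq_complex /= oner_eq0 andbF.
by rewrite eq_complex /= eqxx andbT intr_eq0.
Qed.

Lemma antimode_period n : antimode n pi - antimode n (- pi) =
  if n == 0 then (2 * pi)%:C else 0.
Proof.
rewrite /antimode; case: eqP => [_|_].
  by rewrite -rmorphB /= opprK mulrDl mul1r.
rewrite /fmode addNr mulr0 cis0 mulr1.
by rewrite (_ : pi + pi = 2 * pi) ?cis_mul2pi ?mulr1 ?subrr // mulrDl mul1r.
Qed.

Lemma cintegral_modes n (c : 'I_n -> R[i]) (m : 'I_n -> int) :
  cintegral `](- pi), pi[ (fun x => \sum_(j < n) c j * fmode (m j) x) =
  \sum_(j < n | m j == 0) c j * (2 * pi)%:C.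
Proof.
rewrite (@cintegral_FTC2 (fun x => \sum_(j < n) c j * antimode (m j) x) _
   (fun x => \sum_(j < n) c j * (('i * (m j)%:~R%:C) * fmode (m j) x))).
- rewrite -sumrB [RHS]big_mkcond /=; apply: eq_bigr => j _.
  by rewrite -mulrBr antimode_period; case: ifP; rewrite ?mulr0.
- by rewrite (lt_trans (y := 0)) ?oppr_lt0 ?pi_gt0.
- by apply: is_cderive_sum => j; apply: is_cderiveZ; apply: is_cderive_antimode.
- by apply: is_cderive_sum => j; apply: is_cderiveZ; apply: is_cderive_fmode.
Qed.

(** Stated for every frequency: where no index matches, the empty sum gives the vanishing used in
    [Hnorm_tpoly]. *)
Lemma fourier_tpoly_sum K p (xi : int) :
  fourier (tpoly K p) xi = \sum_(j < size p | j%:Z - K%:Z == xi) p`_j.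
Proof.
rewrite /fourier.
have -> : (fun x => tpoly K p x * cis (- (xi%:~R * (x + pi)))) =
   (fun x => \sum_(j < size p) p`_j * fmode (j%:Z - K%:Z - xi) x).
  apply/funext => x; rewrite mulr_suml; apply: eq_bigr => j _.
  by rewrite [fmode (_ - xi) x]fmodeD mulrA /fmode mulrNz mulNr.
rewrite cintegral_modes mulr_sumr; apply: eq_big => [j|j _]; first by rewrite subr_eq0.
rewrite mulrCA -rmorphM /= mulVf ?mulr1 //.
by rewrite mulf_neq0 ?pnatr_eq0 // gt_eqF // pi_gt0.
Qed.

Lemma fourier_tpoly K p (j : nat) : fourier (tpoly K p) (j%:Z - K%:Z) = p`_j.
Proof.
rewrite fourier_tpoly_sum.
under eq_bigl => i do rewrite (inj_eq (addIr _)) eqz_nat.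
have [jp|jp] := ltnP j (size p).
  by rewrite (big_pred1 (Ordinal jp)).
rewrite nth_default // big_pred0 // => i; apply/negbTE; apply: contraTneq jp => <-.
by rewrite -ltnNge.
Qed.

Lemma tpoly_inj K : injective (tpoly K).
Proof.
by move=> p q pq; apply/polyP => j; rewrite -!(fourier_tpoly K) pq.
Qed.

(** The Fourier multiplier with symbol [m], acting on coefficients. *)
Definition mult K (m : int -> R[i]) p := \poly_(j < size p) (m (j%:Z - K%:Z) * p`_j).

Lemma coef_mult K m p j : (mult K m p)`_j = m (j%:Z - K%:Z) * p`_j.
Proof.
by rewrite coef_poly; case: ltnP => // ?; rewrite nth_default ?mulr0.
Qed.

Lemma size_mult K m p : (size (mult K m p) <= size p)%N.
Proof. exact: size_poly. Qed.

Lemma cderive_tpoly K p :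
  cderive (tpoly K p) = tpoly K (mult K (fun xi => 'i * xi%:~R%:C) p).
Proof.
apply: is_cderiveE.
apply: eq_is_cderive (is_cderive_sum _ _ _ (fun j : 'I_(size p) =>
  is_cderiveZ p`_j _ _ (is_cderive_fmode (j%:Z - K%:Z)))) => x //.
rewrite (tpolyE (size p)) ?size_mult //; apply: eq_bigr => j _.
by rewrite coef_mult mulrCA mulrA.
Qed.
End Trigo.

(** * Weighted l2 norms of coefficient sequences *)
Section WeightedNorm.
Local Open Scope complex_scope.
Context {R : realType}.
Implicit Types (x t : R) (c : R[i]) (p q : {poly R[i]}) (w : nat -> R).
Local Notation normc := Normc.normc.

(** Lagrange's identity: the double sum of squares below is twice the difference of the two
    sides. *)
Lemma sum_CauchySchwarz n (a b : 'I_n -> R) :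
  (\sum_(i < n) a i * b i) ^+ 2 <= (\sum_(i < n) a i ^+ 2) * (\sum_(i < n) b i ^+ 2).
Proof.
have : 0 <= \sum_(i < n) \sum_(j < n) (a i * b j - a j * b i) ^+ 2.
  by apply: sumr_ge0 => i _; apply: sumr_ge0 => j _; apply: sqr_ge0.
have -> : \sum_(i < n) \sum_(j < n) (a i * b j - a j * b i) ^+ 2 =
  \sum_(i < n) \sum_(j < n) (a i ^+ 2 * b j ^+ 2 + b i ^+ 2 * a j ^+ 2
    - 2 * ((a i * b i) * (a j * b j))).
  by apply: eq_bigr => i _; apply: eq_bigr => j _; ring.
under eq_bigr => i _ do rewrite sumrB big_split /= -!mulr_sumr.
by rewrite sumrB big_split /= -mulr_sumr -!mulr_suml; nra.
Qed.

Lemma normc_ge0 c : 0 <= normc c.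
Proof. by case: c => a b; apply: sqrtr_ge0. Qed.

Lemma normc_sum n (c : 'I_n -> R[i]) : normc (\sum_(i < n) c i) <= \sum_(i < n) normc (c i).
Proof.
elim/big_ind2 : _ => [|x a y b ha hb|//]; first by rewrite Normc.normc0.
exact: le_trans (le_normcD _ _) (lerD ha hb).
Qed.

Lemma normc_real (x : R) : normc x%:C = `|x|.
Proof. by rewrite /= expr0n addr0 sqrtr_sqr. Qed.

Definition wnorm2 w p : R := \sum_(j < size p) w j * normc p`_j ^+ 2.
Definition wnorm w p : R := Num.sqrt (wnorm2 w p).

Section Weight.
Variable w : nat -> R.
Hypothesis w_gt0 : forall j, 0 < w j.

Lemma wnorm2E n p : (size p <= n)%N ->
  wnorm2 w p = \sum_(j < n) w j * normc p`_j ^+ 2.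
Proof.
move=> pn; rewrite /wnorm2.
rewrite (big_ord_widen n (fun j => w j * normc p`_j ^+ 2) pn) big_mkcond /=.
apply: eq_bigr => j _; case: ltnP => // ?.
by rewrite nth_default // Normc.normc0 expr0n mulr0.
Qed.

Lemma wnorm2_ge0 p : 0 <= wnorm2 w p.
Proof. by apply: sumr_ge0 => j _; rewrite mulr_ge0 ?sqr_ge0 ?(ltW (w_gt0 _)). Qed.

Lemma wnorm_ge0 p : 0 <= wnorm w p.
Proof. exact: sqrtr_ge0. Qed.

Lemma sqr_wnorm p : wnorm w p ^+ 2 = wnorm2 w p.
Proof. by rewrite sqr_sqrtr ?wnorm2_ge0. Qed.

Lemma le_wnorm p B : 0 <= B -> wnorm2 w p <= B ^+ 2 -> wnorm w p <= B.
Proof. by move=> B0 h; rewrite -(ler_pXn2r (ltn0Sn 1)) ?nnegrE ?wnorm_ge0 // sqr_wnorm. Qed.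

Lemma wnorm0 : wnorm w 0 = 0.
Proof. by rewrite /wnorm /wnorm2 size_poly0 big_ord0 sqrtr0. Qed.

Lemma wnorm_coef p j : w j * normc p`_j ^+ 2 <= wnorm w p ^+ 2.
Proof.
rewrite sqr_wnorm (wnorm2E (maxn (size p) j.+1)) ?leq_maxl //.
rewrite (bigD1 (Ordinal (leq_maxr (size p) j.+1))) //= lerDl.
by apply: sumr_ge0 => i _; rewrite mulr_ge0 ?sqr_ge0 ?(ltW (w_gt0 _)).
Qed.

Lemma wnorm_eq0 p : wnorm w p <= 0 -> p = 0.
Proof.
move=> h; have {}h : wnorm w p = 0 by apply/eqP; rewrite eq_le h wnorm_ge0.
apply/polyP => j; have := wnorm_coef p j; rewrite h expr0n /= coef0 => hj.
apply: Normc.eq0_normc; apply/eqP; rewrite -sqrf_eq0 eq_le sqr_ge0 andbT.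
by rewrite -(pmulr_rle0 _ (w_gt0 j)).
Qed.

Lemma wnorm_le B p q : 0 <= B -> (forall j, normc p`_j <= B * normc q`_j) ->
  wnorm w p <= B * wnorm w q.
Proof.
move=> B0 h; apply: le_wnorm; first by rewrite mulr_ge0 ?wnorm_ge0.
rewrite exprMn sqr_wnorm.
pose n := maxn (size p) (size q).
rewrite (wnorm2E n) ?leq_maxl // [in leRHS](wnorm2E n) ?leq_maxr //.
rewrite mulr_sumr; apply: ler_sum => j _.
rewrite [leRHS]mulrCA ler_wpM2l ?(ltW (w_gt0 _)) // -exprMn.
by rewrite ler_pXn2r ?nnegrE ?mulr_ge0 ?normc_ge0.
Qed.

Lemma wnormZ c p : wnorm w (c *: p) <= normc c * wnorm w p.
Proof.
apply: wnorm_le; first exact: normc_ge0.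
by move=> j; rewrite coefZ Normc.normcM.
Qed.

Lemma wnormN p : wnorm w (- p) = wnorm w p.
Proof.
rewrite /wnorm /wnorm2 size_polyN; congr Num.sqrt.
by apply: eq_bigr => j _; rewrite coefN normcN.
Qed.

Lemma wnormD p q : wnorm w (p + q) <= wnorm w p + wnorm w q.
Proof.
apply: le_wnorm; first by rewrite addr_ge0 ?wnorm_ge0.
pose n := maxn (size p) (size q).
rewrite (wnorm2E n) ?(leq_trans (size_polyD _ _)) //.
rewrite sqrrD !sqr_wnorm (wnorm2E n p) ?leq_maxl // (wnorm2E n q) ?leq_maxr //.
(* The cross term of Minkowski's inequality, by Cauchy-Schwarz with the weight split into two square
   roots. *)
have key : \sum_(j < n) w j * (normc p`_j * normc q`_j) <= wnorm w p * wnorm w q.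
  have s0 : 0 <= \sum_(j < n) w j * (normc p`_j * normc q`_j).
    by apply: sumr_ge0 => j _; rewrite !mulr_ge0 ?normc_ge0 ?(ltW (w_gt0 _)).
  rewrite -(ler_pXn2r (ltn0Sn 1)) ?nnegrE ?mulr_ge0 ?wnorm_ge0 //.
  rewrite exprMn !sqr_wnorm (wnorm2E n p) ?leq_maxl // (wnorm2E n q) ?leq_maxr //.
  have := sum_CauchySchwarz n (fun j => Num.sqrt (w j) * normc p`_j)
                            (fun j => Num.sqrt (w j) * normc q`_j).
  under eq_bigr => j _ do rewrite mulrACA -expr2 sqr_sqrtr ?ltW //.
  under [X in _ <= X * _]eq_bigr => j _ do rewrite exprMn sqr_sqrtr ?ltW //.
  by under [X in _ <= _ * X]eq_bigr => j _ do rewrite exprMn sqr_sqrtr ?ltW //.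
apply: (@le_trans _ _ (\sum_(j < n) (w j * normc p`_j ^+ 2 +
   (w j * (normc p`_j * normc q`_j)) *+ 2 + w j * normc q`_j ^+ 2))).
  apply: ler_sum => j _; rewrite coefD.
  have -> : w j * normc p`_j ^+ 2 + w j * (normc p`_j * normc q`_j) *+ 2 +
      w j * normc q`_j ^+ 2
     = w j * (normc p`_j + normc q`_j) ^+ 2 by ring.
  rewrite ler_wpM2l ?(ltW (w_gt0 _)) // ler_pXn2r ?nnegrE ?addr_ge0 ?normc_ge0 //.
  exact: le_normcD.
rewrite !big_split /= -addrA -[leRHS]addrA lerD2l lerD2r.
by rewrite mulr2n lerD.
Qed.

Lemma wnormB p q : wnorm w (p - q) <= wnorm w p + wnorm w q.
Proof. by rewrite -[wnorm w q]wnormN; exact: wnormD. Qed.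

Lemma wnormB_sym p q : wnorm w (p - q) = wnorm w (q - p).
Proof. by rewrite -opprB wnormN. Qed.
End Weight.

(* Cauchy-Schwarz on each coefficient of the product, splitting the weight as
   [1 = (u v)^(1/2) (u v)^(-1/2)]. *)
Lemma wnormM (u v w : nat -> R) (C : R) p q :
  (forall j, 0 < u j) -> (forall j, 0 < v j) -> (forall j, 0 < w j) -> 0 <= C ->
  (forall m, w m * \sum_(j < m.+1) (u j * v (m - j)%N)^-1 <= C ^+ 2) ->
  wnorm w (p * q) <= C * (wnorm u p * wnorm v q).
Proof.
move=> u0 v0 w0 C0 hC; apply: (le_wnorm _ w0); first by rewrite !mulr_ge0 ?wnorm_ge0.
rewrite !exprMn !sqr_wnorm //.
(* [A] and [B] have the weighted squares as coefficients, so the squared norms are their values at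
   1, and the product of these values is the sum of the coefficients of [A * B], that is, of the
   convolution sums. *)
pose A : {poly R} := \poly_(j < size p) (u j * normc p`_j ^+ 2).
pose B : {poly R} := \poly_(j < size q) (v j * normc q`_j ^+ 2).
have Aj j : A`_j = u j * normc p`_j ^+ 2.
  by rewrite coef_poly; case: ltnP => // ?; rewrite nth_default // Normc.normc0 expr0n mulr0.
have Bj j : B`_j = v j * normc q`_j ^+ 2.
  by rewrite coef_poly; case: ltnP => // ?; rewrite nth_default // Normc.normc0 expr0n mulr0.
have eval1 (D : {poly R}) n : (size D <= n)%N -> D.[1] = \sum_(j < n) D`_j.
  by move=> Dn; rewrite (horner_coef_wide _ Dn); apply: eq_bigr => j _; rewrite expr1n mulr1.
have -> : wnorm2 u p = A.[1].
  by rewrite (eval1 A (size p)) ?size_poly //; apply: eq_bigr => j _; rewrite Aj.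
have -> : wnorm2 v q = B.[1].
  by rewrite (eval1 B (size q)) ?size_poly //; apply: eq_bigr => j _; rewrite Bj.
pose n := maxn (size (p * q)) (size (A * B)).
rewrite (wnorm2E _ n) ?leq_maxl // -hornerM (eval1 (A * B) n) ?leq_maxr //.
rewrite mulr_sumr; apply: ler_sum => m _.
rewrite !coefM.
pose a (j : 'I_m.+1) := Num.sqrt (A`_j * B`_(m - j)).
pose b (j : 'I_m.+1) := Num.sqrt (u j * v (m - j)%N)^-1.
have uv0 (j : 'I_m.+1) : 0 < u j * v (m - j)%N by rewrite mulr_gt0.
have A0 j : 0 <= A`_j by rewrite Aj mulr_ge0 ?sqr_ge0 ?(ltW (u0 _)) ?(ltW (v0 _)).
have B0 j : 0 <= B`_j by rewrite Bj mulr_ge0 ?sqr_ge0 ?(ltW (u0 _)) ?(ltW (v0 _)).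
have e : \sum_(j < m.+1) normc (p`_j * q`_(m - j)) = \sum_(j < m.+1) a j * b j.
  apply: eq_bigr => j _; rewrite /a /b -sqrtrM ?mulr_ge0 // Aj Bj.
  have -> : u j * normc p`_j ^+ 2 * (v (m - j)%N * normc q`_(m - j) ^+ 2) /
      (u j * v (m - j)%N) =
     (normc p`_j * normc q`_(m - j)) ^+ 2.
    by field; rewrite !gt_eqF.
  by rewrite sqrtr_sqr Normc.normcM ger0_norm // mulr_ge0 ?normc_ge0.
have sq : \sum_(j < m.+1) a j ^+ 2 = \sum_(j < m.+1) A`_j * B`_(m - j).
  by apply: eq_bigr => j _; rewrite sqr_sqrtr ?mulr_ge0.
have sqb : \sum_(j < m.+1) b j ^+ 2 = \sum_(j < m.+1) (u j * v (m - j)%N)^-1.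
  by apply: eq_bigr => j _; rewrite sqr_sqrtr // invr_ge0 ltW.
apply: (@le_trans _ _ (w m * (\sum_(j < m.+1) a j * b j) ^+ 2)).
  rewrite ler_wpM2l ?(ltW (w0 _)) // ler_pXn2r ?nnegrE ?normc_ge0 -?e //.
    exact: normc_sum.
  by apply: sumr_ge0 => j _; exact: normc_ge0.
apply: (@le_trans _ _ (w m * ((\sum_(j < m.+1) a j ^+ 2) * (\sum_(j < m.+1) b j ^+ 2)))).
  by rewrite ler_wpM2l ?(ltW (w0 _)) // sum_CauchySchwarz.
rewrite sq sqb mulrCA [leRHS]mulrC ler_wpM2l //.
by apply: sumr_ge0 => j _; rewrite mulr_ge0.
Qed.
End WeightedNorm.

(** * Sobolev norms and the algebra property *)
Section SobolevNorm.
Local Open Scope complex_scope.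
Context {R : realType}.
Implicit Types (c : R[i]) (p q : {poly R[i]}) (gamma : R) (K L : nat).
Local Notation normc := Normc.normc.

Definition sobw gamma (xi : int) : R := (1 + xi%:~R ^+ 2) `^ gamma.

Lemma sobw_base_gt0 (xi : int) : 0 < 1 + xi%:~R ^+ 2 :> R.
Proof. by rewrite ltr_wpDr ?sqr_ge0. Qed.

Lemma sobw_gt0 gamma xi : 0 < sobw gamma xi.
Proof. by rewrite powR_gt0 // sobw_base_gt0. Qed.

Definition hw gamma K (j : nat) : R := sobw gamma (j%:Z - K%:Z).

Lemma hw_gt0 gamma K j : 0 < hw gamma K j.
Proof. exact: sobw_gt0. Qed.

Definition hnorm gamma K p := wnorm (hw gamma K) p.

Lemma Hnorm_tpoly gamma K p : Hnorm gamma (tpoly K p) = (hnorm gamma K p)%:E.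
Proof.
rewrite /Hnorm.
pose A : set int := (fun j : nat => j%:Z - K%:Z) @` `I_(size p).
pose F (xi : int) : \bar R :=
  ((1 + xi%:~R ^+ 2) `^ gamma * normc (fourier (tpoly K p) xi) ^+ 2)%:E.
have F0 xi : (0 <= F xi)%E by rewrite lee_fin mulr_ge0 ?powR_ge0 ?sqr_ge0.
rewrite -[X in poweR X _]/(\esum_(xi in [set: int]) F xi).
(* Outside the finite set [A] all Fourier coefficients vanish, so the sum over all integers is
   finite. *)
have -> : \esum_(xi in [set: int]) F xi = \esum_(xi in A) F xi.
  rewrite [RHS]esum_mkcond; apply: eq_esum => xi _; case: ifPn => // /negP.
  rewrite inE => xiA; rewrite /F fourier_tpoly_sum big_pred0 => [|j].
    by rewrite Normc.normc0 expr0n mulr0.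
  by apply/negbTE/negP => /eqP jxi; apply: xiA; exists j => //=.
rewrite esum_image; last first.
  by move=> i j _ _ /addIr [].
rewrite esum_fset //.
rewrite -fsbig_ord sumEFin poweR_EFin powR12_sqrt.
  congr (Num.sqrt _)%:E; apply: eq_bigr => j _.
  by rewrite fourier_tpoly.
by apply: sumr_ge0 => j _; rewrite -lee_fin; exact: F0.
Qed.

Lemma sobw_le gamma (xi eta : int) : 0 <= gamma ->
  sobw gamma (xi + eta) <= 4 `^ gamma * (sobw gamma xi + sobw gamma eta).
Proof.
move=> g0; rewrite /sobw.
have mono (a b : R) : 0 <= a -> 0 <= b -> a <= b -> a `^ gamma <= b `^ gamma.
  by move=> a0 b0; apply: ge0_ler_powR; rewrite ?nnegrE.
(* The frequency of larger modulus dominates: if |xi| <= |eta|, then 1 + (xi + eta)^2 <= 4 (1 +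
   eta^2). *)
wlog h : xi eta / (xi%:~R ^+ 2 : R) <= eta%:~R ^+ 2.
  move=> H; have [/H//|/ltW/H] := leP (xi%:~R ^+ 2 : R) (eta%:~R ^+ 2).
  by rewrite [eta + xi]addrC [X in _ * X]addrC.
apply: (@le_trans _ _ ((4 * (1 + eta%:~R ^+ 2)) `^ gamma)).
  apply: mono; rewrite ?mulr_ge0 ?(ltW (sobw_base_gt0 _)) //.
  by rewrite intrD; have := sqr_ge0 (xi%:~R - eta%:~R : R); nra.
rewrite powRM ?(ltW (sobw_base_gt0 _)) // ler_wpM2l ?powR_ge0 // lerDr.
exact: powR_ge0.
Qed.

(** Cauchy condensation: the two terms following the first 2j + 1 are each at most 2^(-s) times term
    j. Hence S(n) <= S(2n+1) <= 1 + 2^(1-s) S(n), which is solved for S(n) because 2^(1-s) < 1. *)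
Lemma pseries_bound (s : R) : 1 < s ->
  forall n, \sum_(i < n) (i.+1%:R `^ s)^-1 <= (1 - 2 `^ (1 - s))^-1 :> R.
Proof.
move=> s1.
pose r (i : nat) : R := (i.+1%:R `^ s)^-1.
pose S n : R := \sum_(0 <= i < n) r i.
have r0 i : 0 <= r i by rewrite invr_ge0 powR_ge0.
have s0 : 0 <= s by lra.
have c0 : 0 < 2 `^ (- s) :> R by rewrite powR_gt0.
have c1 : 2 * 2 `^ (- s) = 2 `^ (1 - s) :> R.
  by rewrite powRD ?powRr1 //; apply/implyP => _; rewrite pnatr_eq0.
have c2 : 2 `^ (1 - s) < 1 :> R.
  rewrite -opprB powRN invf_lt1 ?powR_gt0 //.
  have := @gt0_ltr_powR R (s - 1) _ 1 2; rewrite powR1; apply; rewrite ?nnegrE //.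
    by rewrite subr_gt0.
  by rewrite ltr1n.
have rle j i : (j.*2.+1 <= i)%N -> r i <= 2 `^ (- s) * r j.
  move=> ji; rewrite /r powRN -invfM -powRM // -natrM.
  rewrite lef_pV2 ?posrE ?powR_gt0 ?ltr0n //.
  by apply: ge0_ler_powR; rewrite ?nnegrE // ler_nat; lia.
have Sdbl n : S n.*2.+1 <= 1 + 2 `^ (1 - s) * S n.
  elim: n => [|n IH].
    by rewrite /S big_nat1 big_nil mulr0 addr0 /r powR1 invr1.
  rewrite doubleS /S !(big_nat_recr _.+2) // !(big_nat_recr _.*2.+1) //=.
  rewrite (big_nat_recr n) //= mulrDr -/(S n) -/(S n.*2.+1).
  have h1 := rle n n.*2.+1 (leqnn _).
  have h2 := rle n n.*2.+2 (leqnSn _).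
  by move: IH h1 h2; rewrite -c1; nra.
have Smono n : S n <= S n.*2.+1.
  rewrite /S [leRHS](@big_cat_nat _ _ _ n) //=; last by rewrite leqW // -addnn leq_addr.
  by rewrite lerDl sumr_ge0.
move=> n; have h := le_trans (Smono n) (Sdbl n).
rewrite -/(\sum_(i < n) r i) -(big_mkord xpredT) -/(S n).
rewrite -[leRHS]mul1r ler_pdivlMr ?subr_gt0 //; nra.
Qed.

Lemma sobw_summable gamma : 2^-1 < gamma ->
  exists2 S : R, 0 < S & forall K n, \sum_(j < n) (hw gamma K j)^-1 <= S.
Proof.
move=> hg.
have g0 : 0 <= gamma by lra.
have s1 : 1 < 2 * gamma by lra.
pose B := (1 - 2 `^ (1 - 2 * gamma))^-1 : R.
have hB n : \sum_(i < n) (i.+1%:R `^ (2 * gamma))^-1 <= B := pseries_bound _ s1 n.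
have B0 : 0 <= B by have := hB 0%N; rewrite big_ord0.
pose g (m : nat) : R := (sobw gamma m%:Z)^-1.
have gS m : g m.+1 <= (m.+1%:R `^ (2 * gamma))^-1.
  rewrite /g lef_pV2 ?posrE ?powR_gt0 ?sobw_base_gt0 ?ltr0n // powRrM.
  by apply: ge0_ler_powR; rewrite ?nnegrE ?powR_ge0 ?(ltW (sobw_base_gt0 _)) // powR_mulrn // lerDr.
have g1 n : \sum_(0 <= i < n) g i <= 1 + B.
  case: n => [|n]; first by rewrite big_nil; lra.
  rewrite big_nat_recl // lerD //.
    by rewrite /g /sobw expr0n addr0 powR1 invr1.
  rewrite big_mkord; apply: le_trans (hB n); apply: ler_sum => i _; exact: gS.
have g_ge0 i : 0 <= g i by rewrite invr_ge0 ltW // sobw_gt0.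
have hwg K j : (hw gamma K j)^-1 = g `|j%:Z - K%:Z|%N.
  rewrite /g /hw /sobw; congr ((1 + _) `^ _)^-1.
  by rewrite abszE intr_norm real_normK ?num_real.
(* Each sign of the frequency contributes at most 1 + B, the 1 coming from frequency zero; the bound
   does not see the offset. *)
exists (2 * (1 + B)); first by lra.
move=> K n.
(* Lengthening the range to K + n makes a split at index K, where the frequency is zero, always
   possible. *)
apply: (@le_trans _ _ (\sum_(0 <= j < K + n) (hw gamma K j)^-1)).
  rewrite -(big_mkord xpredT (fun j => (hw gamma K j)^-1)).
  rewrite [leRHS](@big_cat_nat _ _ _ n) ?leq_addl //= lerDl sumr_ge0 // => j _.
  by rewrite hwg.
rewrite (@big_cat_nat _ _ _ K) ?leq_addr //=.
rewrite mulr_natl mulr2n lerD //.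
  rewrite big_nat_rev /= add0n; apply: le_trans (g1 K.+1).
  rewrite big_nat_recl // -[leLHS]add0r lerD //; apply: ler_sum_nat => j /andP[_ jK].
  by rewrite hwg (_ : `|_|%N = j.+1) //; lia.
rewrite -[X in \sum_(X <= _ < _) _]add0n big_addn addKn; apply: le_trans (g1 n).
by apply: ler_sum_nat => j _; rewrite hwg (_ : `|_|%N = j) //; lia.
Qed.

Lemma hnormM gamma : 2^-1 < gamma ->
  exists2 C : R, 0 < C & forall K L p q,
    hnorm gamma (K + L) (p * q) <= C * (hnorm gamma K p * hnorm gamma L q).
Proof.
move=> hg; have [S S0 hS] := sobw_summable _ hg.
have D0 : 0 < 4 `^ gamma * (2 * S) by rewrite !mulr_gt0 // powR_gt0.
exists (Num.sqrt (4 `^ gamma * (2 * S))); first by rewrite sqrtr_gt0.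
move=> K L p q; apply: wnormM; try exact: hw_gt0; first exact: sqrtr_ge0.
move=> m; rewrite sqr_sqrtr ?(ltW D0) // mulr_sumr.
apply: (@le_trans _ _ (\sum_(j < m.+1) 4 `^ gamma *
   ((hw gamma K j)^-1 + (hw gamma L (m - j)%N)^-1))).
  apply: ler_sum => j _.
  have jm : (j <= m)%N by rewrite -ltnS.
  have a0 := hw_gt0 gamma K j; have b0 := hw_gt0 gamma L (m - j)%N.
  rewrite ler_pdivrMr ?mulr_gt0 //.
  have -> : 4 `^ gamma * ((hw gamma K j)^-1 + (hw gamma L (m - j)%N)^-1) *
     (hw gamma K j * hw gamma L (m - j)%N) =
     4 `^ gamma * (hw gamma K j + hw gamma L (m - j)%N).
    by field; rewrite !gt_eqF.
  rewrite {1}/hw (_ : _ - _ = (j%:Z - K%:Z) + ((m - j)%N%:Z - L%:Z)); last by lia.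
  by apply: sobw_le; lra.
rewrite -mulr_sumr ler_wpM2l ?powR_ge0 // big_split /= mulr_natl mulr2n lerD //; first exact: hS.
rewrite (reindex_inj rev_ord_inj) /=.
apply: le_trans (hS L m.+1); apply: ler_sum => j _.
by rewrite subSS subKn // -ltnS.
Qed.
End SobolevNorm.

(** * The Crank-Nicolson map on coefficients *)
Section CrankNicolson.
Local Open Scope complex_scope.
Context {R : realType}.
Implicit Types (c : R[i]) (a b p q : {poly R[i]}) (eps tau mu gamma : R) (K L N k : nat).
Local Notation normc := Normc.normc.

Lemma trigpolyP N u : ~~ odd N ->
  trigpoly N u <-> exists2 p : {poly R[i]}, (size p <= N.+1)%N & u = tpoly N./2 p.
Proof.
move=> evN; split=> [[c ->]|[p pN ->]].
  exists (\poly_(j < N.+1) c (freq N j)); first exact: size_poly.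
  apply/funext => x; rewrite (tpolyE N.+1) ?size_poly //.
  by apply: eq_bigr => j _; rewrite coef_poly ltn_ord.
exists (fun xi : int => p`_(absz (xi + N./2%:Z))); apply/funext => x.
rewrite (tpolyE N.+1) //; apply: eq_bigr => j _.
by rewrite /freq subrK.
Qed.

(** Symbols of the derivative and of A^+ and A^-, where [mu] stands for eps^2 tau / 2. *)
Definition dsym (xi : int) : R[i] := 'i * xi%:~R%:C.
Definition Apsym mu (xi : int) : R[i] := 1 + mu%:C * dsym xi ^+ 3.
Definition Amsym mu (xi : int) : R[i] := 1 - mu%:C * dsym xi ^+ 3.

Lemma mult_mult K m1 m2 p : mult K m1 (mult K m2 p) = mult K (fun xi => m1 xi * m2 xi) p.
Proof. by apply/polyP => j; rewrite !coef_mult mulrA. Qed.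

Lemma multB K m p q : mult K m (p - q) = mult K m p - mult K m q.
Proof. by apply/polyP => j; rewrite coefB !coef_mult coefB mulrBr. Qed.

Lemma iter3_cderive_tpoly K p :
  iter 3 cderive (tpoly K p) = tpoly K (mult K (fun xi => dsym xi ^+ 3) p).
Proof.
rewrite /= !cderive_tpoly !mult_mult; congr (tpoly _ (mult _ _ _)).
by apply/funext => xi; rewrite /dsym; ring.
Qed.

Lemma Aplus_tpoly eps tau K p :
  Aplus eps tau (tpoly K p) = tpoly K (mult K (Apsym (2^-1 * eps ^+ 2 * tau)) p).
Proof.
apply/funext => x; rewrite /Aplus iter3_cderive_tpoly -tpolyZ -tpolyD.
by congr (tpoly _ _ x); apply/polyP => j; rewrite coefD coefZ !coef_mult mulrDl mul1r mulrA.
Qed.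

Lemma Aminus_tpoly eps tau K p :
  Aminus eps tau (tpoly K p) = tpoly K (mult K (Amsym (2^-1 * eps ^+ 2 * tau)) p).
Proof.
apply/funext => x; rewrite /Aminus iter3_cderive_tpoly -tpolyZ -tpolyB.
by congr (tpoly _ _ x); apply/polyP => j; rewrite coefB coefZ !coef_mult mulrBl mul1r mulrA.
Qed.

Lemma ApsymE mu xi : Apsym mu xi = 1 +i* (- (mu * xi%:~R ^+ 3)).
Proof.
apply/eqP; rewrite /Apsym /dsym eq_complex /=; apply/andP; split; apply/eqP;
  rewrite ?exprS ?expr0 /=; ring.
Qed.

Lemma AmsymE mu xi : Amsym mu xi = 1 +i* (mu * xi%:~R ^+ 3).
Proof.
apply/eqP; rewrite /Amsym /dsym eq_complex /=; apply/andP; split; apply/eqP;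
  rewrite ?exprS ?expr0 /=; ring.
Qed.

(** The symbol of the third derivative is purely imaginary, so that of A^+ has real part 1. *)
Lemma normc_Apsym_ge1 mu xi : 1 <= normc (Apsym mu xi).
Proof.
rewrite ApsymE /= expr1n -[leLHS]sqrtr1 ler_wsqrtr // lerDl; exact: sqr_ge0.
Qed.

Lemma Apsym_neq0 mu xi : Apsym mu xi != 0.
Proof.
apply/eqP => h; have := normc_Apsym_ge1 mu xi.
by rewrite h Normc.normc0 ler10.
Qed.

(** The two symbols are complex conjugates: the linear part of the scheme is an isometry. *)
Lemma normc_AmsymV mu xi : normc ((Apsym mu xi)^-1 * Amsym mu xi) = 1.
Proof.
rewrite Normc.normcM Normc.normcV.
have -> : normc (Amsym mu xi) = normc (Apsym mu xi).
  by rewrite ApsymE AmsymE /= sqrrN.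
by rewrite mulVf // gt_eqF // (lt_le_trans ltr01) // normc_Apsym_ge1.
Qed.

Lemma normc_dsym xi : normc (dsym xi) = `|xi%:~R|.
Proof.
rewrite /dsym Normc.normcM normc_real /=.
by rewrite expr0n expr1n add0r sqrtr1 mul1r.
Qed.

Lemma normc_dsymV mu xi : normc ((Apsym mu xi)^-1 * dsym xi) <= `|xi%:~R|.
Proof.
rewrite Normc.normcM Normc.normcV normc_dsym ler_piMl //.
by rewrite invf_le1 ?normc_Apsym_ge1 // (lt_le_trans ltr01) // normc_Apsym_ge1.
Qed.

(** [Aplus_inv] is an inverse by choice, so its value is pinned down by injectivity of [Aplus] on
    Y_N together with an explicit preimage [q] in Y_N. *)
Lemma Aplus_inv_tpoly eps tau N p : ~~ odd N -> (size p <= N.+1)%N ->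
  Aplus_inv eps tau N (tpoly N./2 p) =
  tpoly N./2 (mult N./2 (fun xi => (Apsym (2^-1 * eps ^+ 2 * tau) xi)^-1) p).
Proof.
move=> evN pN; set mu := 2^-1 * eps ^+ 2 * tau.
have inj : {in trigpoly N &, injective (@Aplus R eps tau)}.
  move=> u v /set_mem/(trigpolyP _ _ evN)[a _ ->] /set_mem/(trigpolyP _ _ evN)[b _ ->].
  rewrite !Aplus_tpoly => /tpoly_inj ab; congr tpoly; apply/polyP => j.
  by move/polyP: ab => /(_ j); rewrite !coef_mult => /mulfI; apply; apply: Apsym_neq0.
set q := mult _ _ _.
have -> : p = mult N./2 (Apsym mu) q.
  by apply/polyP => j; rewrite !coef_mult mulrA divff ?mul1r // Apsym_neq0.
rewrite -Aplus_tpoly /Aplus_inv pinvKV //.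
by apply/mem_set/(trigpolyP _ _ evN); exists q => //; rewrite (leq_trans (size_mult _ _ _)).
Qed.

(* Passing from offset [N./2 + d] to offset [N./2] drops the [d] lowest and all
   the too high frequencies. *)
Definition ptrunc N d p := \poly_(j < N.+1) p`_(j + d).

Lemma ptruncB N d p q : ptrunc N d (p - q) = ptrunc N d p - ptrunc N d q.
Proof.
by apply/polyP => j; rewrite coefB !coef_poly; case: ifP; rewrite ?coefB ?subr0.
Qed.

Lemma projY_tpoly N d p : projY N (tpoly (N./2 + d) p) = tpoly N./2 (ptrunc N d p).
Proof.
apply/funext => x; rewrite /projY (tpolyE N.+1) ?size_poly //.
apply: eq_bigr => j _; rewrite /freq coef_poly ltn_ord -(fourier_tpoly (N./2 + d)).
by congr (fourier _ _ * _); lia.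
Qed.

(** The index shift by d compensates the change of offset: surviving coefficients keep their
    frequency and weight, the others contribute nonnegative terms. *)
Lemma hnorm_ptrunc gamma N d p :
  hnorm gamma N./2 (ptrunc N d p) <= hnorm gamma (N./2 + d) p.
Proof.
apply: le_wnorm; [exact: hw_gt0|exact: wnorm_ge0|].
rewrite sqr_wnorm; last exact: hw_gt0.
rewrite (wnorm2E _ N.+1) ?size_poly // (wnorm2E _ (maxn (size p) (d + N.+1))) ?leq_maxl //.
set n := maxn _ _.
pose F j := hw gamma (N./2 + d) j * normc p`_j ^+ 2.
have F0 j : 0 <= F j by rewrite mulr_ge0 ?sqr_ge0 ?(ltW (hw_gt0 _ _ _)).
apply: (@le_trans _ _ (\sum_(0 <= j < N.+1) F (j + d)%N)).
  rewrite big_mkord; apply: ler_sum => j _; rewrite coef_poly ltn_ord /F.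
  by rewrite /hw (_ : (j + d)%N%:Z - _ = j%:Z - N./2%:Z) //; lia.
have -> : \sum_(0 <= j < N.+1) F (j + d)%N = \sum_(d <= j < d + N.+1) F j.
  by rewrite -[X in \sum_(X <= _ < d + _) _]add0n big_addn addKn.
rewrite -(big_mkord xpredT F).
rewrite [leRHS](@big_cat_nat _ _ _ d) /=; [|by []|by rewrite /n; lia].
rewrite [X in _ <= _ + X](@big_cat_nat _ _ _ (d + N.+1)) /=; [|by lia|by rewrite /n; lia].
by rewrite addrCA lerDl addr_ge0 // sumr_ge0.
Qed.

(** [t] stands for tau / k, and [N./2 * k.-1] is the excess of the offset of a k-th power over
    [N./2]. *)
Definition Psi mu (t : R) N k a b :=
  mult N./2 (fun xi => (Apsym mu xi)^-1 * Amsym mu xi) a -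
  t%:C *: mult N./2 (fun xi => (Apsym mu xi)^-1 * dsym xi)
    (ptrunc N (N./2 * k.-1) ((2^-1 *: (a + b)) ^+ k)).

(** No bound on [b] is required: the truncation limits the nonlinear part. *)
Lemma size_Psi mu t N k a b : (size a <= N.+1)%N -> (size (Psi mu t N k a b) <= N.+1)%N.
Proof.
move=> aN; rewrite (leq_trans (size_polyD _ _)) // geq_max size_polyN.
rewrite (leq_trans (size_mult _ _ _)) //=.
by rewrite (leq_trans (size_scale_leq _ _)) // (leq_trans (size_mult _ _ _)) // size_poly.
Qed.

Lemma psi_tpoly eps tau N k a b : ~~ odd N -> (0 < k)%N -> (size a <= N.+1)%N ->
  psi eps tau N k (tpoly N./2 a) (tpoly N./2 b) =
  tpoly N./2 (Psi (2^-1 * eps ^+ 2 * tau) (tau / k%:R) N k a b).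
Proof.
move=> evN k0 aN; apply/funext => x; rewrite /psi.
have -> : (fun y => ((tpoly N./2 a y + tpoly N./2 b y) / 2) ^+ k) =
   tpoly (N./2 + N./2 * k.-1) ((2^-1 *: (a + b)) ^+ k).
  apply/funext => y; rewrite -mulnS prednK // tpolyX tpolyZ tpolyD.
  by rewrite [_ / 2]mulrC.
rewrite projY_tpoly cderive_tpoly Aminus_tpoly !Aplus_inv_tpoly //; last 2 first.
- by rewrite (leq_trans (size_mult _ _ _)) // size_poly.
- by rewrite (leq_trans (size_mult _ _ _)).
by rewrite !mult_mult -tpolyZ -tpolyB.
Qed.

(** As N is even, the indices up to N carry exactly the frequencies of modulus at most N/2, so the
    symbol is bounded only there. *)
Lemma hnorm_mult gamma N m B p : 0 <= B -> (size p <= N.+1)%N ->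
  (forall xi : int, (`|xi| <= N./2)%N -> normc (m xi) <= B) -> ~~ odd N ->
  hnorm gamma N./2 (mult N./2 m p) <= B * hnorm gamma N./2 p.
Proof.
move=> B0 pN hm evN; apply: wnorm_le => //; first exact: hw_gt0.
move=> j; rewrite coef_mult Normc.normcM.
have [jN|jN] := ltnP j N.+1.
  by rewrite ler_wpM2r ?normc_ge0 // hm //; lia.
by rewrite nth_default ?(leq_trans pN) // Normc.normc0 !mulr0.
Qed.

(** * Lipschitz and ball estimates for the Crank-Nicolson map *)

Section PowerBound.
Variables (gamma C : R).
Hypothesis C0 : 0 < C.
Hypothesis hC : forall K L p q,
  hnorm gamma (K + L) (p * q) <= C * (hnorm gamma K p * hnorm gamma L q).

Lemma hnorm_exp K n p :
  hnorm gamma (K * n.+1) (p ^+ n.+1) <= C ^+ n * hnorm gamma K p ^+ n.+1.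
Proof.
elim: n => [|n IH]; first by rewrite muln1 !expr1 expr0 mul1r.
rewrite mulnS [p ^+ _]exprS; apply: le_trans (hC _ _ _ _) _.
rewrite [C ^+ _]exprS [hnorm gamma K p ^+ _]exprS -mulrA ler_wpM2l ?(ltW C0) //.
by rewrite [leRHS]mulrCA ler_wpM2l ?wnorm_ge0.
Qed.

Lemma hnorm_expB K n r p q : hnorm gamma K p <= r -> hnorm gamma K q <= r ->
  hnorm gamma (K * n.+1) (p ^+ n.+1 - q ^+ n.+1) <=
  n.+1%:R * (C * r) ^+ n * hnorm gamma K (p - q).
Proof.
move=> pr qr; have r0 : 0 <= r by apply: le_trans pr; exact: wnorm_ge0.
elim: n => [|n IH]; first by rewrite muln1 !expr1 expr0 !mul1r.
(* Discrete product rule; each step adds one more term of size (C r)^n times the norm of p - q. *)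
have -> : p ^+ n.+2 - q ^+ n.+2 = p * (p ^+ n.+1 - q ^+ n.+1) + (p - q) * q ^+ n.+1.
  by rewrite mulrBr mulrBl -!exprS addrA subrK.
rewrite mulnS; apply: le_trans (wnormD _ (hw_gt0 _ _) _ _) _.
have d0 : 0 <= hnorm gamma K (p - q) by exact: wnorm_ge0.
have h1 : hnorm gamma (K + K * n.+1) (p * (p ^+ n.+1 - q ^+ n.+1)) <=
   C * (r * (n.+1%:R * (C * r) ^+ n * hnorm gamma K (p - q))).
  apply: le_trans (hC _ _ _ _) _; rewrite ler_wpM2l ?(ltW C0) //.
  by apply: ler_pM; rewrite ?wnorm_ge0.
have h2 : hnorm gamma (K + K * n.+1) ((p - q) * q ^+ n.+1) <=
   C * (hnorm gamma K (p - q) * (C ^+ n * r ^+ n.+1)).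
  apply: le_trans (hC _ _ _ _) _; rewrite ler_wpM2l ?(ltW C0) //.
  apply: ler_pM; rewrite ?wnorm_ge0 //; apply: le_trans (hnorm_exp _ _ _) _.
  by rewrite ler_wpM2l ?exprn_ge0 ?(ltW C0) // ler_pXn2r ?nnegrE ?wnorm_ge0.
apply: le_trans (lerD h1 h2) _; rewrite le_eqVlt; apply/orP; left; apply/eqP.
by rewrite -[n.+2%:R]natr1 !exprMn !exprS; ring.
Qed.

Variables (mu t : R) (N k : nat) (a : {poly R[i]}) (M : R).
Hypotheses (evN : ~~ odd N) (k0 : (0 < k)%N) (t0 : 0 <= t) (M0 : 0 < M).
Hypotheses (aN : (size a <= N.+1)%N) (aM : hnorm gamma N./2 a <= M).
(** With t = tau / k this bounds tau N (2 C M)^(k-1) by 1; since the derivative costs N/2 rather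
    than N, the nonlinear part gets the constant 1/2. *)
Hypothesis small : t * k%:R * N%:R * (C * (2 * M)) ^+ k.-1 <= 1.

Lemma hnorm_half p : hnorm gamma N./2 (2^-1 *: p) <= 2^-1 * hnorm gamma N./2 p.
Proof.
apply: le_trans (wnormZ _ (hw_gt0 _ _) _ _) _.
have -> : 2^-1 = (2^-1 : R)%:C :> R[i] by rewrite fmorphV rmorph_nat.
by rewrite normc_real ger0_norm // invr_ge0.
Qed.

Lemma hnorm_nonlin p q : hnorm gamma N./2 p <= 2 * M -> hnorm gamma N./2 q <= 2 * M ->
  hnorm gamma N./2 (t%:C *: mult N./2 (fun xi => (Apsym mu xi)^-1 * dsym xi)
    (ptrunc N (N./2 * k.-1) (p ^+ k - q ^+ k))) <= 2^-1 * hnorm gamma N./2 (p - q).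
Proof.
move=> pr qr; apply: le_trans (wnormZ _ (hw_gt0 _ _) _ _) _.
rewrite normc_real ger0_norm //.
have h1 : hnorm gamma N./2 (mult N./2 (fun xi => (Apsym mu xi)^-1 * dsym xi)
    (ptrunc N (N./2 * k.-1) (p ^+ k - q ^+ k))) <=
    N./2%:R * (k%:R * (C * (2 * M)) ^+ k.-1 * hnorm gamma N./2 (p - q)).
  apply: le_trans (@hnorm_mult _ _ _ N./2%:R _ _ _ _ _) _ => //.
  - exact: size_poly.
  - move=> xi hxi; apply: le_trans (normc_dsymV _ _) _.
    by rewrite -intr_norm -abszE ler_nat.
  rewrite ler_wpM2l //; apply: le_trans (hnorm_ptrunc _ _ _ _) _.
  by rewrite -mulnS prednK // -{1 2 3 4}(prednK k0) hnorm_expB.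
apply: le_trans (ler_wpM2l t0 h1) _; rewrite !mulrA ler_wpM2r ?wnorm_ge0 //.
have e : N%:R = 2 * N./2%:R :> R by rewrite -natrM; congr _%:R; lia.
rewrite -(ler_pM2l (ltr0n R 2)) divff // ; apply: le_trans small.
by rewrite e !mulrA le_eqVlt; apply/orP; left; apply/eqP; ring.
Qed.

Lemma Psi_half_contraction b b' :
  hnorm gamma N./2 b <= 2 * M -> hnorm gamma N./2 b' <= 2 * M ->
  hnorm gamma N./2 (Psi mu t N k a b - Psi mu t N k a b') <=
  2^-1 * hnorm gamma N./2 (b - b').
Proof.
move=> hb hb'.
have half q : hnorm gamma N./2 q <= 2 * M -> hnorm gamma N./2 (2^-1 *: (a + q)) <= 2 * M.
  move=> hc; apply: le_trans (hnorm_half _) _.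
  have : hnorm gamma N./2 (a + q) <= hnorm gamma N./2 a + hnorm gamma N./2 q.
    exact: wnormD (hw_gt0 _ _) _ _.
  by move: aM hc M0; lra.
(* The linear part depends on [a] only and cancels; the minus sign in [Psi] swaps b and b'. *)
have -> : Psi mu t N k a b - Psi mu t N k a b' =
   t%:C *: mult N./2 (fun xi => (Apsym mu xi)^-1 * dsym xi)
    (ptrunc N (N./2 * k.-1) ((2^-1 *: (a + b')) ^+ k - (2^-1 *: (a + b)) ^+ k)).
  by rewrite /Psi ptruncB multB scalerBr; ring.
apply: le_trans (hnorm_nonlin _ _ (half _ hb') (half _ hb)) _.
(* Averaging with [a] halves the difference once more; this gain is given away. *)
rewrite -scalerBr opprD addrACA subrr add0r ler_wpM2l // ?invr_ge0 //.
apply: le_trans (hnorm_half _) _; rewrite /hnorm wnormB_sym.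
by have := wnorm_ge0 (hw gamma N./2) (b' - b); lra.
Qed.

Lemma Psi_ball b : hnorm gamma N./2 b <= 2 * M ->
  hnorm gamma N./2 (Psi mu t N k a b) <= 2 * M.
Proof.
move=> hb; apply: le_trans (wnormB _ (hw_gt0 _ _) _ _) _.
have h0 : hnorm gamma N./2 0 <= 2 * M by rewrite /hnorm wnorm0 mulr_ge0 ?(ltW M0).
have hf : hnorm gamma N./2 (2^-1 *: (a + b)) <= 2 * M.
  apply: le_trans (hnorm_half _) _.
  have : hnorm gamma N./2 (a + b) <= hnorm gamma N./2 a + hnorm gamma N./2 b.
    exact: wnormD (hw_gt0 _ _) _ _.
  by move: aM hb M0; lra.
(* Comparison with q = 0, as 0^k = 0: the nonlinear part has norm at most half of 2M, and the linear
   part at most M. *)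
have := hnorm_nonlin _ _ hf h0; rewrite expr0n gtn_eqF // !subr0 => h2.
have h1 : hnorm gamma N./2 (mult N./2 (fun xi => (Apsym mu xi)^-1 * Amsym mu xi) a) <=
      1 * hnorm gamma N./2 a.
  by apply: hnorm_mult => // xi _; rewrite normc_AmsymV.
apply: le_trans (lerD h1 h2) _; move: aM hf M0; lra.
Qed.
End PowerBound.
End CrankNicolson.

(** * Fixed point iteration and step size *)
Section FixedPoint.
Local Open Scope complex_scope.
Context {R : realType}.
Implicit Types (x : nat -> R) (p q : {poly R[i]}).
Local Notation normc := Normc.normc.

Lemma exp2N_small (E e : R) : 0 < e -> exists i : nat, E * 2^-1 ^+ i < e.
Proof.
move=> e0; exists (Num.truncn `|E / e|).
set n := Num.truncn _.
have h : `|E / e| < n.+1%:R by rewrite truncnS_gt.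
have h2 : n.+1%:R <= 2 ^+ n :> R by rewrite -natrX ler_nat ltn_expl.
rewrite exprVn ltr_pdivrMr ?exprn_gt0 // mulrC -ltr_pdivrMr //.
exact: le_lt_trans (ler_norm _) (lt_le_trans h h2).
Qed.

(** Replaces passages to the limit in norm inequalities below. *)
Lemma le_geometric (E a b : R) : (forall i, a <= b + E * 2^-1 ^+ i) -> a <= b.
Proof.
move=> h; rewrite leNgt; apply/negP => ba.
have [i hi] : exists i, E * 2^-1 ^+ i < a - b by apply: exp2N_small; rewrite subr_gt0.
by have := h i; lra.
Qed.

Lemma geometric_limit x (D : R) : (forall i, `|x i.+1 - x i| <= D * 2^-1 ^+ i) ->
  exists l, forall i, `|x i - l| <= 2 * D * 2^-1 ^+ i.
Proof.
move=> hx.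
(* The radius 2 D 2^(-i) is the tail of the geometric series, so the intervals from [y i] to [z i]
   are nested; the limit is the supremum of the left endpoints. *)
pose y i := x i - 2 * D * 2^-1 ^+ i; pose z i := x i + 2 * D * 2^-1 ^+ i.
have halfS i : 2^-1 ^+ i.+1 = 2^-1 * 2^-1 ^+ i :> R by rewrite exprS.
have D0 : 0 <= D by have := hx 0%N; rewrite expr0 mulr1; apply: le_trans.
have ymono : {homo y : i j / (i <= j)%N >-> i <= j}.
  apply/nondecreasing_seqP => i; rewrite /y halfS.
  by have := hx i; rewrite ler_norml => /andP[]; lra.
have zmono : {homo z : i j / (i <= j)%N >-> j <= i}.
  apply/nonincreasing_seqP => i; rewrite /z halfS.
  by have := hx i; rewrite ler_norml => /andP[]; lra.
have yz i j : y i <= z j.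
  apply: (le_trans (ymono _ _ (leq_maxl i j))).
  apply: le_trans (zmono _ _ (leq_maxr i j)).
  have : 0 <= D * 2^-1 ^+ maxn i j :> R by rewrite mulr_ge0 ?exprn_ge0.
  by rewrite /y /z; lra.
have ne : range y !=set0 by exists (y 0%N); exists 0%N.
exists (sup (range y)) => i.
have h1 : y i <= sup (range y).
  apply: ub_le_sup; last by exists i.
  by exists (z 0%N) => _ [j _ <-]; exact: yz.
have h2 : sup (range y) <= z i.
  by apply: ge_sup => // _ [j _ <-]; exact: yz.
rewrite ler_norml; apply/andP; split; move: h1 h2; rewrite /y /z; lra.
Qed.

Lemma geometric_limitC (c : nat -> R[i]) (D : R) :
  (forall i, normc (c i.+1 - c i) <= D * 2^-1 ^+ i) ->
  exists l, forall i, normc (c i - l) <= 4 * D * 2^-1 ^+ i.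
Proof.
move=> hc.
have re (d : R[i]) : `|complex.Re d| <= normc d.
  by case: d => a b /=; rewrite -sqrtr_sqr ler_wsqrtr // lerDl sqr_ge0.
have im (d : R[i]) : `|complex.Im d| <= normc d.
  by case: d => a b /=; rewrite -sqrtr_sqr ler_wsqrtr // lerDr sqr_ge0.
have [lr hr] : exists l, forall i, `|complex.Re (c i) - l| <= 2 * D * 2^-1 ^+ i.
  by apply: geometric_limit => i; apply: le_trans (hc i); rewrite -raddfB; exact: re.
have [li hi] : exists l, forall i, `|complex.Im (c i) - l| <= 2 * D * 2^-1 ^+ i.
  by apply: geometric_limit => i; apply: le_trans (hc i); rewrite -raddfB; exact: im.
exists (lr +i* li) => i.
have -> : c i - (lr +i* li) =
    (complex.Re (c i) - lr)%:C + 'i * (complex.Im (c i) - li)%:C.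
  by rewrite [LHS]complexE complexiE; case: (c i).
apply: le_trans (le_normcD _ _) _.
rewrite Normc.normcM !normc_real (_ : normc 'i = 1) ?mul1r; last first.
  by rewrite /= expr0n expr1n add0r sqrtr1.
by have := hr i; have := hi i; lra.
Qed.

(** * Banach's iteration in a weighted norm *)

Section Contraction.
Variables (w : nat -> R) (n : nat) (r : R).
Variables (F : {poly R[i]} -> {poly R[i]}) (a : {poly R[i]}).
Hypothesis w_gt0 : forall j, 0 < w j.
Hypothesis sizeF : forall p, (size (F p) <= n)%N.
Hypothesis F_ball : forall p, wnorm w p <= r -> wnorm w (F p) <= r.
Hypothesis F_contr : forall p q, wnorm w p <= r -> wnorm w q <= r ->
  wnorm w (F p - F q) <= 2^-1 * wnorm w (p - q).
Hypotheses (an : (size a <= n)%N) (ar : wnorm w a <= r).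

Let u i := iter i F a.
Let d := wnorm w (F a - a).

Lemma iter_ball i : wnorm w (u i) <= r.
Proof. by elim: i => //= i; exact: F_ball. Qed.

Lemma size_iter_contr i : (size (u i) <= n)%N.
Proof. by case: i => //= i. Qed.

Lemma iter_step i : wnorm w (u i.+1 - u i) <= d * 2^-1 ^+ i.
Proof.
elim: i => [|i IH]; first by rewrite expr0 mulr1.
apply: le_trans (F_contr _ _ (iter_ball i.+1) (iter_ball i)) _.
by rewrite exprS mulrCA ler_wpM2l.
Qed.

Lemma iter_cvg : exists2 l : {poly R[i]}, (size l <= n)%N &
  exists E, forall i, wnorm w (u i - l) <= E * 2^-1 ^+ i.
Proof.
pose D j := d / Num.sqrt (w j).
have sw j : 0 < Num.sqrt (w j) by rewrite sqrtr_gt0.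
(* By [wnorm_coef] one coefficient is controlled by the norm at the price of 1 / sqrt(w j). *)
have coefs j : exists l, forall i, normc ((u i)`_j - l) <= 4 * D j * 2^-1 ^+ i.
  apply: geometric_limitC => i; rewrite -coefB /D mulrAC ler_pdivlMr //.
  apply: le_trans (iter_step i).
  rewrite -(ler_pXn2r (ltn0Sn 1)) ?nnegrE ?wnorm_ge0 ?mulr_ge0 ?normc_ge0 ?sqrtr_ge0 //.
  rewrite exprMn sqr_sqrtr ?(ltW (w_gt0 _)) // mulrC.
  exact: wnorm_coef.
have /choice[l hl] := coefs.
exists (\poly_(j < n) l j); first exact: size_poly.
(* Only n coefficients occur, so the coefficientwise rates add up to a rate in norm. *)
pose E2 := \sum_(j < n) w j * (4 * D j) ^+ 2.
have E0 : 0 <= E2 by apply: sumr_ge0 => j _; rewrite mulr_ge0 ?sqr_ge0 ?(ltW (w_gt0 _)).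
exists (Num.sqrt E2) => i.
apply: (le_wnorm _ w_gt0); first by rewrite mulr_ge0 ?sqrtr_ge0 ?exprn_ge0.
rewrite exprMn sqr_sqrtr // (wnorm2E _ n); last first.
  by rewrite (leq_trans (size_polyD _ _)) // geq_max size_polyN size_poly size_iter_contr.
rewrite mulr_suml; apply: ler_sum => j _.
rewrite -mulrA ler_wpM2l ?(ltW (w_gt0 _)) // -exprMn coefB coef_poly ltn_ord.
by rewrite ler_pXn2r ?nnegrE ?normc_ge0 ?(le_trans (normc_ge0 _) (hl _ _)) //.
Qed.

Lemma contraction_fixed_point : exists l : {poly R[i]},
  [/\ (size l <= n)%N, wnorm w l <= r, F l = l,
     (forall q, wnorm w q <= r -> F q = q -> q = l) &
     forall i, wnorm w (u i - l) <= 2 * d * 2^-1 ^+ i].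
Proof.
have [l ln [E hE]] := iter_cvg.
have lr : wnorm w l <= r.
  apply: (@le_geometric E) => i; apply: le_trans (lerD (iter_ball i) (hE i)).
  rewrite -[X in wnorm w X <= _](subKr (u i)).
  exact: wnormB.
have Fl : F l = l.
  apply/eqP; rewrite -subr_eq0; apply/eqP; apply: (wnorm_eq0 _ w_gt0).
  apply: (@le_geometric E) => i; rewrite add0r.
  (* Both terms are at most half of E 2^(-i), the second one by contraction. *)
  have -> : F l - l = (u i.+1 - l) - (F (u i) - F l) by rewrite /u /=; ring.
  apply: le_trans (wnormB _ w_gt0 _ _) _.
  have h1 := hE i.+1; have h2 := F_contr _ _ (iter_ball i) lr; have h3 := hE i.
  by move: h1 h2 h3; rewrite exprS; lra.
exists l; split => //.
  move=> q qr Fq; apply/eqP; rewrite -subr_eq0; apply/eqP; apply: (wnorm_eq0 _ w_gt0).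
  by have := F_contr _ _ qr lr; rewrite Fq Fl; lra.
have contr i : wnorm w (u i.+1 - l) <= 2^-1 * wnorm w (u i - l).
  by rewrite -[X in _ - X]Fl; apply: F_contr => //; exact: iter_ball.
elim=> [|i IH]; last by apply: le_trans (contr i) _; rewrite exprS; move: IH; lra.
rewrite expr0 mulr1.
(* Origin of the factor 2: the distance e from the start to l satisfies e <= d + e/2. *)
have : wnorm w (u 0%N - l) <= d + wnorm w (u 1%N - l).
  rewrite [leRHS]addrC /d (_ : u 0%N - l = (u 1%N - l) - (F a - a)).
    exact: wnormB.
  by rewrite /u /=; ring.
by have := contr 0%N; lra.
Qed.
End Contraction.

(** The threshold T solves C0 T^sigma = delta^(1+sigma). If tau N exceeded delta, then (tau
    N)^(1+sigma), which is tau^sigma times tau N^(1+sigma), would exceed this common value, although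
    it is at most T^sigma C0. *)
Lemma step_size (sigma C0 delta : R) : 0 < sigma -> 0 < C0 -> 0 < delta ->
  exists2 tauM : R, 0 < tauM & forall (tau : R) (N : nat), (0 < N)%N ->
    0 < tau <= tauM -> tau <= C0 * N%:R `^ (- (1 + sigma)) -> tau * N%:R <= delta.
Proof.
move=> s0 C00 d0; set T := (delta `^ (1 + sigma) / C0) `^ sigma^-1.
have Tbase : 0 < delta `^ (1 + sigma) / C0 by rewrite divr_gt0 ?powR_gt0.
exists T; first by rewrite powR_gt0.
move=> tau N N0 /andP[t0 tT] hN.
have N0' : 0 < N%:R :> R by rewrite ltr0n.
have s1 : 0 < 1 + sigma by lra.
rewrite leNgt; apply/negP => h.
have := @gt0_ltr_powR R (1 + sigma) s1 delta (tau * N%:R).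
rewrite !nnegrE (ltW d0) mulr_ge0 ?(ltW t0) ?(ltW N0') // => /(_ isT isT h).
apply/negP; rewrite -leNgt powRM ?(ltW t0) ?(ltW N0') //.
rewrite powRD; last by rewrite gt_eqF ?implybT.
rewrite powRr1 ?(ltW t0) //.
have h1 : tau * N%:R `^ (1 + sigma) <= C0.
  by rewrite -ler_pdivlMr ?powR_gt0 // -powRN.
have h2 : tau `^ sigma <= delta `^ (1 + sigma) / C0.
  have -> : delta `^ (1 + sigma) / C0 = T `^ sigma.
    by rewrite /T -powRrM mulVf ?lt0r_neq0 // powRr1 // ltW.
  by apply: ge0_ler_powR; rewrite ?nnegrE ?(ltW t0) ?(ltW s0) ?powR_ge0.
have -> : tau * tau `^ sigma * N%:R `^ (1 + sigma) =
  tau `^ sigma * (tau * N%:R `^ (1 + sigma)) by ring.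
rewrite -[leRHS](divfK (lt0r_neq0 C00)).
by apply: ler_pM; rewrite ?powR_ge0 ?mulr_ge0 ?powR_ge0 ?(ltW t0).
Qed.
End FixedPoint.

Theorem corollary3p4 (R : realType) (k : nat) (gamma sigma0 C0 M : R)
    (hk : (2 <= k)%N) (hgamma : 2^-1 < gamma) (hsigma0 : 0 < sigma0)
    (hC0 : 0 < C0) (hM : 0 < M) :
  exists tauM : R, 0 < tauM /\
    forall (eps tau : R) (N : nat),
      0 < eps <= 1 ->
      (0 < N)%N -> ~~ odd N ->
      0 < tau <= tauM ->
      tau <= C0 * Num.min (eps `^ (1 + sigma0)) (N%:R `^ (- (1 + sigma0))) ->
      forall w : R -> R[i],
        trigpoly N w -> (Hnorm gamma w <= M%:E)%E ->
        exists u : R -> R[i],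
          [/\ ballY N gamma (2 * M) u,
              u = psi eps tau N k w u,
              (forall v : R -> R[i],
                 ballY N gamma (2 * M) v -> v = psi eps tau N k w v -> v = u),
              (fun i => Hnorm gamma (picard eps tau N k w i \- u)) @ \oo
                --> 0%E
            & forall i : nat,
                (Hnorm gamma (picard eps tau N k w i \- u)%R <=
                 ((2 ^ (i%:Z - 1))^-1)%:E *
                 Hnorm gamma (picard eps tau N k w 1 \- picard eps tau N k w 0)%R)%E].
Proof.
have [C CC hC] := @hnormM R gamma hgamma.
have CM0 : 0 < (C * (2 * M)) ^+ k.-1 by rewrite exprn_gt0 // !mulr_gt0.
have k0 : (0 < k)%N by apply: leq_trans hk.
have kR : k%:R != 0 :> R by rewrite pnatr_eq0 -lt0n.
(* The bound on tau N is chosen to give exactly the hypothesis [small]. *)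
have [tauM tauM0 htau] := step_size sigma0 C0 ((C * (2 * M)) ^+ k.-1)^-1 hsigma0 hC0
  (etrans (invr_gt0 _) CM0).
exists tauM; split=> // eps tau N _ N0 evN taub tauN w /(trigpolyP _ _ evN)[a aN ->{w}].
rewrite Hnorm_tpoly lee_fin => aM.
have t0 : 0 < tau by case/andP: taub.
pose t := tau / k%:R; pose mu := 2^-1 * eps ^+ 2 * tau.
have tk0 : 0 <= t by rewrite divr_ge0 ?ler0n // ltW.
have small : t * k%:R * N%:R * (C * (2 * M)) ^+ k.-1 <= 1.
  rewrite /t divfK // -ler_pdivlMr // div1r; apply: htau => //.
  apply: le_trans tauN _; rewrite ler_wpM2l ?(ltW hC0) //.
  by rewrite ge_min lexx orbT.
have a2M : hnorm gamma N./2 a <= 2 * M by move: aM hM; lra.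
pose F := Psi mu t N k a.
have psiE b : psi eps tau N k (tpoly N./2 a) (tpoly N./2 b) = tpoly N./2 (F b).
  exact: psi_tpoly.
have picardE i : picard eps tau N k (tpoly N./2 a) i = tpoly N./2 (iter i F a).
  by elim: i => //= i IH; rewrite /picard /= -/(picard _ _ _ _ _ i) IH psiE.
have subE p q : tpoly N./2 p \- tpoly N./2 q = tpoly N./2 (p - q) :> (R -> R[i]).
  by apply/funext => x; rewrite tpolyB.
have [l [lN l2M Fl uniq err]] := @contraction_fixed_point R (hw gamma N./2) N.+1 (2 * M) F a
  (hw_gt0 _ _) (fun p => size_Psi _ _ _ _ _ p aN)
  (Psi_ball gamma C CC hC mu t N k a M evN k0 tk0 hM aN aM small)
  (Psi_half_contraction gamma C CC hC mu t N k a M evN k0 tk0 hM aN aM small) aN a2M.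
exists (tpoly N./2 l); split.
- split; first by apply/(trigpolyP _ _ evN); exists l.
  by rewrite Hnorm_tpoly lee_fin.
- by rewrite psiE Fl.
- move=> v [/(trigpolyP _ _ evN)[b bN ->]]; rewrite Hnorm_tpoly lee_fin psiE => b2M.
  by move=> /tpoly_inj bF; rewrite (uniq b).
- under eq_fun => i do rewrite picardE subE Hnorm_tpoly.
  apply: cvg_EFin; first by near=> i.
  apply: (@squeeze_cvgr _ _ _ _ (fun=> 0)
    (fun i => 2 * wnorm (hw gamma N./2) (F a - a) * 2^-1 ^+ i)).
  + by near=> i; rewrite wnorm_ge0 err.
  + exact: cvg_cst.
  + apply: cvg_geometric; rewrite ger0_norm ?invf_lt1 ?invr_ge0 //; lra.
- move=> i; rewrite !picardE !subE !Hnorm_tpoly -EFinM lee_fin.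
  (* The exponent is an integer, so i = 0 is covered with the value 2; this is the factor 2 d 2^(-i)
     of the fixed point lemma. *)
  have -> : (2 ^ (i%:Z - 1))^-1 = 2 * 2^-1 ^+ i :> R.
    by rewrite expfzDr // exprN1 invfM invrK mulrC exprVn.
  by rewrite mulrAC; exact: err.
Unshelve. all: by end_near.
Qed.
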